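(* (Completeness.) Let $\Sigma$ be a signature and $\varphi,\psi$ formulas over $\Sigma$. If $\varphi\vdash\psi$ is not derivable in $\mathsf{QRC_1}$, then there exist an adequate relational model $\mathcal M$, a world $w\in W$ and a $w$-assignment $g$ such that $\mathcal M,w\Vdash^g\varphi$ and $\mathcal M,w\not\Vdash^g\psi$.
   Context: The logic $\mathsf{QRC_1}$. Fix a countable set of variables. A signature $\Sigma$ is a set of constants and a set of relation symbols with arities (no function symbols). A term is a variable or a constant. Formulas are built from $\top$ and $S(t_0,\dots,t_{n-1})$ ($S$ $n$-ary, $t_i$ terms) by $\wedge$, the unary modality $\Diamond$, and $\forall x$. $\mathrm{fv}(\varphi)$ is the set of free variables; $\varphi[x\leftarrow t]$ is simultaneous replacement of free occurrences of $x$ by $t$; $t$ is free for $x$ in $\varphi$ if no variable of $t$ becomes bound in $\varphi[x\leftarrow t]$. $\mathsf{QRC_1}$ derives sequents $\varphi\vdash\psi$ by: (i) $\varphi\vdash\top$, $\varphi\vdash\varphi$; (ii) $\varphi\wedge\psi\vdash\varphi$, $\varphi\wedge\psi\vdash\psi$; (iii) from $\varphi\vdash\psi$, $\varphi\vdash\chi$ infer $\varphi\vdash\psi\wedge\chi$; (iv) from $\varphi\vdash\psi$, $\psi\vdash\chi$ infer $\varphi\vdash\chi$; (v) from $\varphi\vdash\psi$ infer $\Diamond\varphi\vdash\Diamond\psi$; (vi) $\Diamond\Diamond\varphi\vdash\Diamond\varphi$; (vii) $\Diamond\forall x\varphi\vdash\forall x\Diamond\varphi$; (viii) from $\varphi\vdash\psi$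 infer $\varphi\vdash\forall x\psi$ if $x\notin\mathrm{fv}(\varphi)$; (ix) from $\varphi[x\leftarrow t]\vdash\psi$ infer $\forall x\varphi\vdash\psi$ if $t$ is free for $x$ in $\varphi$; (x) from $\varphi\vdash\psi$ infer $\varphi[x\leftarrow t]\vdash\psi[x\leftarrow t]$ if $t$ is free for $x$ in $\varphi$ and $\psi$; (xi) from $\varphi[x\leftarrow c]\vdash\psi[x\leftarrow c]$ infer $\varphi\vdash\psi$ if the constant $c$ occurs in neither $\varphi$ nor $\psi$. Relational semantics. A frame is $\langle W,R,\{M_w\}_{w\in W}\rangle$ with $W$ a nonempty set of worlds, $R$ a binary relation on $W$, and each $M_w$ a finite set. A relational model adds, for each $w$, an interpretation $I_w$ assigning to each constant $c$ an element $c^{I_w}\in M_w$, and $J_w$ assigning to each $n$-ary relation symbol $S$ a set $S^{J_w}\subseteq (M_w)^n$. The model is adequate if $R$ is transitive, inclusive ($wRu\Rightarrow M_w\subseteq M_u$) and concordant ($wRu\Rightarrow c^{I_w}=c^{I_u}$). A $w$-assignment is a map $g$ from variables to $M_w$, extended by $g(c):=c^{I_w}$; if $wRv$, $g^\iota$ is $g$ regarded as a $v$-assignment. $g\sim_x h$ means $g,h$ agree except possibly at $x$. Truth: $\mathcal M,w\Vdash^g\top$ always; $\mathcal M,w\Vdash^g S(t_0,\dots,t_{n-1})$ iff $\langle g(t_0),\dots,g(t_{n-1})\rangle\in S^{J_w}$; $\wedge$ componentwise; $\mathcal M,w\Vdash^g\Diamond\varphi$ iff there is $v$ with $wRv$ and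 $\mathcal M,v\Vdash^{g^\iota}\varphi$; $\mathcal M,w\Vdash^g\forall x\varphi$ iff $\mathcal M,w\Vdash^h\varphi$ for all $w$-assignments $h\sim_x g$. *)

(* Defs.v *)
From mathcomp Require Import all_boot.
From mathcomp Require Import finmap.

Set Implicit Arguments.
Unset Strict Implicit.
Unset Printing Implicit Defensive.

Local Open Scope fset_scope.

Definition var := nat.

Record signature := Signature {
  constant : Type;
  relsym : Type;
  arity : relsym -> nat
}.

Inductive term (Sg : signature) :=
| Var of var
| Const of constant Sg.

Inductive formula (Sg : signature) :=
| Top
| Rel (P : relsym Sg) of (arity P).-tuple (term Sg)
| And of formula Sg & formula Sg
| Dia of formula Sg
| All of var & formula Sg.

Arguments Var {Sg}.
Arguments Const {Sg}.
Arguments Top {Sg}.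
Arguments Rel {Sg}.
Arguments And {Sg}.
Arguments Dia {Sg}.
Arguments All {Sg}.

Section Syntax.
Variable Sg : signature.
Implicit Types (s t : term Sg) (A B C : formula Sg) (x y : var)
  (c : constant Sg).

Definition tfv t : {fset var} :=
  if t is Var x then [fset x] else fset0.

Fixpoint fv A : {fset var} :=
  match A with
  | Top => fset0
  | Rel _ ts => \bigcup_(t <- ts) tfv t
  | And B C => fv B `|` fv C
  | Dia B => fv B
  | All x B => fv B `\ x
  end.

Definition tsubst x t s : term Sg :=
  match s with
  | Var y => if y == x then t else s
  | Const _ => s
  end.

(* Bound variables are never renamed, so capture is possible;
   see [free_for]. *)
Fixpoint subst x t A : formula Sg :=
  match A with
  | Top => Top
  | Rel P ts => Rel P (map_tuple (tsubst x t) ts)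
  | And B C => And (subst x t B) (subst x t C)
  | Dia B => Dia (subst x t B)
  | All y B => if y == x then A else All y (subst x t B)
  end.

(* A quantifier that has no free occurrence of x in its scope captures
   nothing, even if its variable occurs in t. *)
Fixpoint free_for t x A : bool :=
  match A with
  | Top => true
  | Rel _ _ => true
  | And B C => free_for t x B && free_for t x C
  | Dia B => free_for t x B
  | All y B =>
      (x \in fv (All y B)) ==> ((y \notin tfv t) && free_for t x B)
  end.

Fixpoint const_occurs c A : Prop :=
  match A with
  | Top => False
  | Rel _ ts => exists i, tnth ts i = Const c
  | And B C => const_occurs c B \/ const_occurs c C
  | Dia B => const_occurs c B
  | All _ B => const_occurs c B
  end.

Inductive derives : formula Sg -> formula Sg -> Prop :=
| der_top A : derives A Top
| der_refl A : derives A A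
| der_andl A B : derives (And A B) A
| der_andr A B : derives (And A B) B
| der_and A B C : derives A B -> derives A C -> derives A (And B C)
| der_cut A B C : derives A B -> derives B C -> derives A C
| der_nec A B : derives A B -> derives (Dia A) (Dia B)
| der_trans A : derives (Dia (Dia A)) (Dia A)
| der_dia_all x A : derives (Dia (All x A)) (All x (Dia A))
| der_all_r x A B : x \notin fv A -> derives A B -> derives A (All x B)
| der_all_l x t A B :
    free_for t x A -> derives (subst x t A) B -> derives (All x A) B
| der_inst x t A B :
    free_for t x A -> free_for t x B ->
    derives A B -> derives (subst x t A) (subst x t B)
| der_const x c A B :
    ~ const_occurs c A -> ~ const_occurs c B ->
    derives (subst x (Const c) A) (subst x (Const c) B) -> derives A B.

End Syntax.

(* The domains of all worlds are finite subsets of a common [universe], so that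
   inclusion between domains and equality of interpretations across worlds
   make sense. *)
Record frame := Frame {
  world : Type;
  world_inhabited : inhabited world;
  acc : world -> world -> Prop;
  universe : choiceType;
  dom : world -> {fset universe}
}.

Record model (Sg : signature) := Model {
  model_frame :> frame;
  cinterp : world model_frame -> constant Sg -> universe model_frame;
  cinterp_dom : forall w c, cinterp w c \in dom w;
  rinterp : world model_frame -> forall P : relsym Sg,
    (arity P).-tuple (universe model_frame) -> Prop;
  rinterp_dom : forall w P (ds : (arity P).-tuple (universe model_frame)),
    rinterp w ds -> {subset ds <= dom w}
}.

Section Semantics.
Variables (Sg : signature) (M : model Sg).
Implicit Types (w v : world M) (g h : var -> universe M).

Record adequate : Prop := Adequate {
  acc_transitive : forall w v u, acc w v -> acc v u -> acc w u;
  acc_inclusive : forall w v, acc w v -> dom w `<=` dom v;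
  acc_concordant : forall w v, acc w v -> forall c : constant Sg,
    cinterp w c = cinterp v c
}.

Definition is_assignment w g : Prop := forall x, g x \in dom w.

Definition agree_except (x : var) g h : Prop :=
  forall y, y != x -> g y = h y.

Definition teval w g (t : term Sg) : universe M :=
  match t with
  | Var x => g x
  | Const c => cinterp w c
  end.

(* Only meaningful when [g] is a w-assignment and [M] is inclusive. Assignments
   take values in the universe, so in the clause for [Dia] the w-assignment [g]
   regarded as a v-assignment is [g] itself. *)
Fixpoint sat w g (A : formula Sg) : Prop :=
  match A with
  | Top => True
  | Rel _ ts => rinterp w (map_tuple (teval w g) ts)
  | And B C => sat w g B /\ sat w g C
  | Dia B => exists v, acc w v /\ sat v g B
  | All x B => forall h, is_assignment w h -> agree_except x h g -> sat w h B
  end.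

End Semantics.

(* Main.v *)
(** Because the language is strictly positive, a single formula [A] can serve
   as a world, with [A] related to [C] when [A] derives [Dia C] and truth of
   [B] at [A] meaning that [A] derives [B]; no maximal consistent sets are
   required.  Let [K] bound all variables of the two given formulas.  The domain
   of a world consists of their constants together with finitely many
   variables of index at least [K], so that instantiation never captures a
   variable.  An assignment matters only at the variables below [K], so among
   [K + 1] domain variables that are not free in [A] one is not a value of the
   assignment, and it acts as an eigenvariable: this is why finite domains
   suffice. *)
Require Import Defs.
From mathcomp Require Import all_boot.
From mathcomp Require Import finmap.
From mathcomp Require Import boolp.

Set Implicit Arguments.
Unset Strict Implicit.
Unset Printing Implicit Defensive.

Local Open Scope fset_scope.
Local Open Scope nat_scope.

(** * Simultaneous substitution and its interplay with [subst], [fv] and [bv] *)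

Section SimultaneousSubstitution.
Variable Sg : signature.
Implicit Types (s t : term Sg) (A B C : formula Sg) (x y z : var)
  (g h : var -> term Sg).

Definition tbind g t : term Sg := if t is Var x then g x else t.

Definition update g x t : var -> term Sg := fun y => if y == x then t else g y.

(** As with [subst], bound variables keep their names, so capture has to be excluded by side
    conditions. *)
Fixpoint msubst g A : formula Sg :=
  match A with
  | Top => Top
  | Rel P ts => Rel P (map_tuple (tbind g) ts)
  | And B C => And (msubst g B) (msubst g C)
  | Dia B => Dia (msubst g B)
  | All x B => All x (msubst (update g x (Var x)) B)
  end.

Fixpoint bv A : {fset var} :=
  match A with
  | Top | Rel _ _ => fset0
  | And B C => bv B `|` bv C
  | Dia B => bv B
  | All x B => x |` bv B
  end.

Lemma update_neq g x t y : y != x -> update g x t y = g y.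
Proof. by rewrite /update => /negbTE ->. Qed.

Lemma in_tfv x t : (x \in tfv t) <-> t = Var x.
Proof.
case: t => [y|c] /=; last by rewrite inE; split.
by rewrite inE; split=> [/eqP ->|[->]].
Qed.

Lemma in_fv_Rel x P (ts : (arity P).-tuple (term Sg)) :
  (x \in fv (Rel P ts)) <-> exists i, tnth ts i = Var x.
Proof.
rewrite /= big_tuple; split=> [/bigfcupP[i _ /in_tfv]|[i /in_tfv xi]].
  by exists i.
by apply/bigfcupP; exists i; rewrite ?mem_index_enum.
Qed.

Lemma eq_msubst g h A :
  (forall x, x \in fv A -> g x = h x) -> msubst g A = msubst h A.
Proof.
elim: A g h => [|P ts|B IHB C IHC|B IHB|x B IHB] g h //= gh.
- congr Rel; apply: eq_from_tnth => i; rewrite !tnth_map.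
  case E: (tnth ts i) => [x|c] //=.
  by apply: gh; apply/(in_fv_Rel _ ts); exists i.
- by rewrite (IHB g h) ?(IHC g h) // => x xB; apply: gh; rewrite inE xB ?orbT.
- by rewrite (IHB g h).
- congr All; apply: IHB => y yB; rewrite /update; case: eqP => // /eqP yx.
  by apply: gh; rewrite !inE yx.
Qed.

Lemma msubst_Var A : msubst Var A = A.
Proof.
elim: A => [|P ts|B IHB C IHC|B IHB|x B IHB] //=; rewrite ?IHB ?IHC //.
- by congr Rel; apply: eq_from_tnth => i; rewrite tnth_map; case: (tnth ts i).
- congr All; rewrite -[RHS]IHB; apply: eq_msubst => y _.
  by rewrite /update; case: eqP => [->|].
Qed.

Lemma in_fv_msubst z g A :
  z \in fv (msubst g A) -> exists2 u, u \in fv A & g u = Var z.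
Proof.
elim: A g => [|P ts|B IHB C IHC|B IHB|x B IHB] g.
- by rewrite inE.
- move/in_fv_Rel=> [i]; rewrite tnth_map; case E: (tnth ts i) => [u|c] //= gu.
  by exists u => //; apply/(in_fv_Rel _ ts); exists i.
- by rewrite /= inE => /orP[/IHB|/IHC] [u uA gu]; exists u; rewrite // inE uA ?orbT.
- exact: IHB.
- rewrite /= !inE => /andP[zx /IHB[u uB]]; rewrite /update.
  case: eqP => [_ [xz]|/eqP ux gu]; first by rewrite xz eqxx in zx.
  by exists u; rewrite // !inE ux.
Qed.

Lemma bv_msubst g A : bv (msubst g A) = bv A.
Proof. by elim: A g => //= [B IHB C IHC|x B IHB] g; rewrite ?IHB ?IHC. Qed.

(** [subst z t] stops at a quantifier over [z], so it reaches every [Var z] produced by [g] only if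
    none lies below such a quantifier. A free [z] of [A] is never in that position. *)
Lemma subst_msubst z t g A :
    (forall u, u \in fv A -> g u = Var z -> u = z \/ z \notin bv A) ->
  subst z t (msubst g A) = msubst (fun u => tsubst z t (g u)) A.
Proof.
elim: A g => [|P ts|B IHB C IHC|B IHB|x B IHB] g gz //=.
- by congr Rel; apply: eq_from_tnth => i; rewrite !tnth_map; case: (tnth ts i).
- rewrite IHB ?IHC // => u uA /gz; rewrite /= !inE uA ?orbT negb_or.
    by case=> // [->|/andP[_ ?]]; [left|right].
  by case=> // [->|/andP[? _]]; [left|right].
- by rewrite IHB.
- case: eqP => [xz|/eqP xz].
    congr All; apply: eq_msubst => u uB; rewrite /update.
    case: eqP => // /eqP ux; case E: (g u) => [y|c] //=.
    case: eqP => // yz; rewrite yz in E.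
    have := gz u; rewrite /= !inE ux uB xz eqxx => /(_ isT E).
    by case=> // uz; rewrite uz xz eqxx in ux.
  congr All; rewrite IHB.
    apply: eq_msubst => u uB; rewrite /update; case: eqP => //= _.
    by rewrite (negbTE xz).
  move=> u uB; rewrite /update.
  case: eqP => [_ [xz']|/eqP ux gu]; first by rewrite xz' eqxx in xz.
  have := gz u; rewrite /= !inE ux uB negb_or => /(_ isT gu).
  by case=> [|/andP[_ ?]]; [left|right].
Qed.

Lemma free_for_bv t x A :
  (forall y, y \in bv A -> y \notin tfv t) -> free_for t x A.
Proof.
elim: A => [|P ts|B IHB C IHC|B IHB|y B IHB] //= tA; last 1 first.
- apply/implyP => _; rewrite tA ?IHB // ?inE ?eqxx // => z zB.
  by apply: tA; rewrite inE zB orbT.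
- by rewrite IHB ?IHC // => y yA; apply: tA; rewrite inE yA ?orbT.
Qed.

(* [z] occurs in [msubst g A] only where [A] has [x] free, so putting [x] back
   captures nothing. *)
Lemma free_for_msubst x z g A :
    z \notin bv A -> (forall u, u \in fv A -> g u = Var z -> u = x) ->
  free_for (Var x) z (msubst g A).
Proof.
elim: A g => [|P ts|B IHB C IHC|B IHB|y B IHB] g //=.
- rewrite inE negb_or => /andP[zB zC] gz.
  by rewrite IHB ?IHC // => u uA; apply: gz; rewrite inE uA ?orbT.
- exact: IHB.
- rewrite !inE negb_or => /andP[zy zB] gz.
  have gz' u : u \in fv B -> update g y (Var y) u = Var z -> u != y /\ u = x.
    rewrite /update => uB; case: eqP => [_ [yz]|/eqP uy gu].
      by rewrite yz eqxx in zy.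
    by split=> //; apply: gz; rewrite // !inE uy.
  apply/implyP => /andP[_ /in_fv_msubst[u uB /(gz' u uB)[uy ux]]].
  have yx : y != x by rewrite -ux eq_sym.
  by rewrite yx IHB // => v vB /(gz' v vB)[].
Qed.

End SimultaneousSubstitution.

(** * Finite bounds on the variables and constants of a formula *)

Section Within.
Variable Sg : signature.
Implicit Types (A B : formula Sg) (L : seq {classic (Defs.constant Sg)}).

Definition twithin (K : nat) L (t : term Sg) : bool :=
  match t with
  | Var x => x < K
  | Const c => (c : {classic (Defs.constant Sg)}) \in L
  end.

Fixpoint within (K : nat) L A : bool :=
  match A with
  | Top => true
  | Rel _ ts => all (twithin K L) ts
  | And B C => within K L B && within K L C
  | Dia B => within K L B
  | All x B => (x < K) && within K L B
  end.

Lemma twithin_mono K K' L L' t :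
  K <= K' -> {subset L <= L'} -> twithin K L t -> twithin K' L' t.
Proof.
by case: t => [x|c] KK' LL' /= => [/leq_trans|]; [exact|exact: LL'].
Qed.

Lemma within_mono K K' L L' A :
  K <= K' -> {subset L <= L'} -> within K L A -> within K' L' A.
Proof.
move=> KK' LL'.
elim: A => [|P ts|B IHB C IHC|B IHB|x B IHB] //=.
- by apply: sub_all => t; exact: twithin_mono.
- by move=> /andP[/IHB-> /IHC->].
- by move=> /andP[/leq_trans->// /IHB->].
Qed.

Lemma all_twithin_exists (ts : seq (term Sg)) :
  exists K L, all (twithin K L) ts.
Proof.
elim: ts => [|t ts [K [L tsKL]]]; first by exists 0, [::].
case: t => [x|c].
  exists (maxn x.+1 K), L; rewrite /= leq_maxl /=.
  by apply: sub_all tsKL => t; apply: twithin_mono; rewrite ?leq_maxr.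
exists K, ((c : {classic _}) :: L); rewrite /= mem_head /=.
apply: sub_all tsKL => t; apply: twithin_mono => // d dL.
by rewrite inE dL orbT.
Qed.

Lemma within_join K K' L L' A B : within K L A -> within K' L' B ->
  within (maxn K K') (L ++ L') A && within (maxn K K') (L ++ L') B.
Proof.
move=> wA wB; apply/andP; split.
  apply: within_mono wA; rewrite ?leq_maxl // => c cL.
  by rewrite mem_cat cL.
apply: within_mono wB; rewrite ?leq_maxr // => c cL.
by rewrite mem_cat cL orbT.
Qed.

Lemma within_exists A : exists K L, within K L A.
Proof.
elim: A => [|P ts|B [K [L wB]] C [K' [L' wC]]|B IHB|x B [K [L wB]]] //=.
- by exists 0, [::].
- exact: all_twithin_exists.
- by exists (maxn K K'), (L ++ L'); apply: within_join.
- exists (maxn x.+1 K), L; rewrite leq_maxl /=.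
  by apply: within_mono wB; rewrite ?leq_maxr.
Qed.

Lemma within_fv K L A x : within K L A -> x \in fv A -> x < K.
Proof.
elim: A => [|P ts|B IHB C IHC|B IHB|y B IHB].
- by rewrite inE.
- by move=> /all_tnthP wts /in_fv_Rel[i tsi]; have := wts i; rewrite tsi.
- by move=> /= /andP[/IHB wB /IHC wC]; rewrite inE => /orP[].
- exact: IHB.
- by move=> /= /andP[_ /IHB wB]; rewrite !inE => /andP[_ /wB].
Qed.

Lemma within_bv K L A x : within K L A -> x \in bv A -> x < K.
Proof.
elim: A => [|P ts|B IHB C IHC|B IHB|y B IHB] //=; rewrite ?inE //.
- by move=> /andP[/IHB wB /IHC wC] /orP[].
- by move=> /andP[yK /IHB wB] /orP[/eqP->|].
Qed.

(* The shifted variables are put back one at a time; the induction is on the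
   number [j] of those already restored. *)
Lemma derives_unshift K L A B : within K L A -> within K L B ->
  derives (msubst (fun x => Var (K + x)) A) (msubst (fun x => Var (K + x)) B) ->
  derives A B.
Proof.
move=> wA wB AB.
(* [g j] interpolates between the shift ([j = 0]) and, below [K], the identity ([j = K]). *)
pose g j x : term Sg := if x < j then Var x else Var (K + x).
have gA C : within K L C -> msubst (g K) C = C.
  move=> wC; rewrite -[RHS]msubst_Var; apply: eq_msubst => x /(within_fv wC) xK.
  by rewrite /g xK.
have gj j : j <= K -> derives (msubst (g j) A) (msubst (g j) B).
  elim: j => [_|j IHj jK]; first exact: AB.
  have bvK C : within K L C -> K + j \notin bv C.
    by move=> wC; apply/negP => /(within_bv wC); rewrite ltnNge leq_addr.
  have gu C : within K L C ->
      forall u, u \in fv C -> g j u = Var (K + j) -> u = j.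
    move=> wC u /(within_fv wC) uK; rewrite /g; case: ifP => _ [].
      by move=> uKj; move: uK; rewrite uKj ltnNge leq_addr.
    by move/addnI.
  (* Below [K] only [j] is sent to [Var (K + j)], so a single substitution leads from [g j] to
     [g j.+1]. *)
  have gS C : within K L C ->
      msubst (g j.+1) C = subst (K + j) (Var j) (msubst (g j) C).
    move=> wC; rewrite subst_msubst; last by move=> *; right; exact: bvK.
    apply: eq_msubst => u uC; have uK := within_fv wC uC.
    rewrite /g ltnS leq_eqVlt; case: ltnP => uj /=.
      by rewrite orbT ltn_eqF // ltn_addr.
    by rewrite orbF eqn_add2l; case: eqP => [->|].
  rewrite !gS //; apply: der_inst; last exact/IHj/ltnW.
    by apply: free_for_msubst; [exact: bvK|exact: gu].
  by apply: free_for_msubst; [exact: bvK|exact: gu].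
by rewrite -(gA A) // -(gA B) //; exact: gj.
Qed.

End Within.

(** * The canonical model and its truth lemma *)

Section CanonicalModel.
Variables (Sg : signature) (K : nat) (L : seq {classic (Defs.constant Sg)}).
Implicit Types (A B C : formula Sg).

(** The height is stored apart from the theory: domains must not shrink along [cacc], although the
    theory of a successor may have fewer free variables. *)
Record cworld := CWorld {
  theory : formula Sg;
  height : nat;
  fv_height : forall x, x \in fv theory -> x < height
}.

Lemma cworld_exists A n : exists w : cworld, theory w = A /\ n <= height w.
Proof.
have fvA x : x \in fv A -> x < maxn n (\max_(y <- fv A) y).+1.
  by move=> xA; rewrite leq_max ltnS (leq_bigmax_seq (F := id)) ?orbT.
by exists (CWorld fvA); rewrite leq_maxl.
Qed.

(** The variables [K + i] with [height w <= i] are not free in the theory. The domain has [K.+1] of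
    them, one more than the variables at which an assignment matters. *)
Definition cdom (w : cworld) : {fset {classic (term Sg)}} :=
  [fset (Const c : {classic (term Sg)}) | c : {classic Defs.constant Sg} in L] `|`
  [fset (Var (K + i) : {classic (term Sg)}) | i : nat in iota 0 (height w + K.+1)].

Definition cacc (w v : cworld) : Prop :=
  derives (theory w) (Dia (theory v)) /\ height w <= height v.

Lemma mem_cdom_Var w i :
  i < height w + K.+1 -> (Var (K + i) : {classic _}) \in cdom w.
Proof.
move=> iw; rewrite inE; apply/orP; right; apply/imfsetP; exists i => //=.
by rewrite mem_iota.
Qed.

Lemma cdom_high w (t : {classic (term Sg)}) x :
  t \in cdom w -> x < K -> x \notin tfv t.
Proof.
rewrite inE => /orP[] /imfsetP[a /= _ ->] /= xK //.
by rewrite inE; apply: contraTneq xK => ->; rewrite -leqNgt leq_addr.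
Qed.

Lemma cdom_mono w v : height w <= height v -> cdom w `<=` cdom v.
Proof.
move=> wv; apply/fsubsetP => t; rewrite inE => /orP[tL|].
  by rewrite inE tL.
move=> /imfsetP[i /=]; rewrite mem_iota add0n => /andP[_ iw] ->.
by apply: mem_cdom_Var; apply: leq_trans iw _; rewrite leq_add2r.
Qed.

Definition cframe : frame :=
  @Frame cworld (let: ex_intro w _ := cworld_exists Top 0 in inhabits w)
    cacc {classic (term Sg)} cdom.

(* Constants foreign to the two formulas are irrelevant and are all sent to one
   element, since domains are finite. *)
Definition cconst (w : cworld) (c : Defs.constant Sg) : {classic (term Sg)} :=
  if (c : {classic (Defs.constant Sg)}) \in L then Const c else Var (K + 0).

Lemma cconst_dom w c : cconst w c \in cdom w.
Proof.
rewrite /cconst; case: ifP => cL; last by apply: mem_cdom_Var; rewrite addnS.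
by rewrite inE; apply/orP; left; apply/imfsetP; exists c.
Qed.

Definition crel (w : cworld) P (ds : (arity P).-tuple {classic (term Sg)}) :
    Prop :=
  derives (theory w) (Rel P (ds : (arity P).-tuple (term Sg))) /\
  {subset ds <= cdom w}.

Definition cmodel : model Sg :=
  @Model Sg cframe cconst cconst_dom crel (fun w P ds => @proj2 _ _).

Lemma cmodel_adequate : adequate cmodel.
Proof.
(* Concordance holds by computation, as [cconst] ignores the world. *)
split=> [w v u [wv hwv] [vu hvu]|w v [_]|//].
  split; last exact: leq_trans hvu.
  by apply: der_cut wv _; apply: der_cut (der_trans _); apply: der_nec.
exact: cdom_mono.
Qed.

(** Pigeonhole: [K.+1] distinct candidates against at most [K] values of [g] below [K]. *)
Lemma fresh_variable (w : cworld) (g : var -> {classic (term Sg)}) :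
  exists2 i, height w <= i < height w + K.+1 &
    forall u, u < K -> g u <> Var (K + i).
Proof.
pose s := [seq (Var (K + i) : {classic (term Sg)}) | i <- iota (height w) K.+1].
have us : uniq s by rewrite map_inj_uniq ?iota_uniq // => i j [/addnI].
have : ~~ all [in [seq g u | u <- iota 0 K]] s.
  apply/negP => /allP ss; have := uniq_leq_size us ss.
  by rewrite !size_map !size_iota ltnn.
move=> /allPn[t /mapP[i iw ->{t}] /negP gi].
exists i => [|u uK gu]; first by rewrite -mem_iota.
apply: gi; apply/mapP; exists u => //.
by rewrite mem_iota.
Qed.

(** By the first hypothesis the quantified variable is the only source of [x] in the substituted
    body, so replacing [x] by [t] there amounts to updating [g]. *)
Lemma derives_All_elim A x B g t :
    (forall u, u \in fv (All x B) -> g u <> Var x) ->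
    (forall y, y \in bv B -> y \notin tfv t) ->
  derives A (msubst g (All x B)) -> derives A (msubst (update g x t) B).
Proof.
move=> gx tB AB; apply: der_cut AB _; apply: (der_all_l (t := t)).
  by apply: free_for_bv => y; rewrite bv_msubst; exact: tB.
have gx' u : u \in fv B -> u != x -> g u <> Var x.
  by move=> uB ux; apply: gx; rewrite !inE ux.
rewrite subst_msubst; last first.
  by move=> u uB; rewrite /update; case: eqP => [|/eqP ux /(gx' u uB ux)]; [left|].
rewrite (eq_msubst (h := update g x t)); first exact: der_refl.
move=> u uB; rewrite /update; case: eqP => /= [_|/eqP ux]; first by rewrite eqxx.
case E: (g u) => [y|c] //=; case: eqP => // yx.
by case: (gx' u uB ux); rewrite E yx.
Qed.

(** Since [x] may be free in [A], generalisation is over the eigenvariable [z]; the quantifier is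
    then renamed to [x]. *)
Lemma derives_All_intro A x z B g :
    z \notin fv A -> z \notin bv B ->
    (forall u, u \in fv (All x B) -> g u <> Var z) ->
    (forall u, u \in fv (All x B) -> g u <> Var x) -> z != x ->
  derives A (msubst (update g x (Var z)) B) -> derives A (msubst g (All x B)).
Proof.
move=> zA zB gz gx zx AB.
apply: der_cut (der_all_r zA AB) _.
have gz' u : u \in fv B -> update g x (Var z) u = Var z -> u = x.
  rewrite /update => uB; case: eqP => // /eqP ux gu.
  by case: (gz u); rewrite // !inE ux.
(* Renaming: [x] is not free in the formula quantified over [z], and instantiating [z] with [x]
   gives the wanted body. *)
apply: der_all_r.
  rewrite /= !inE negb_and; apply/orP; right; apply/negP => /in_fv_msubst[u uB].
  rewrite /update; case: eqP => [_ [zx']|/eqP ux gu].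
    by rewrite zx' eqxx in zx.
  by case: (gx u); rewrite // !inE ux.
apply: (der_all_l (t := Var x)); first exact: free_for_msubst.
rewrite subst_msubst; last by right.
rewrite (eq_msubst (h := update g x (Var x))); first exact: der_refl.
move=> u uB; rewrite /update; case: eqP => /= [_|/eqP ux]; first by rewrite eqxx.
case E: (g u) => [y|c] //=; case: eqP => // yz.
by case: (gz u); rewrite ?E ?yz // !inE ux.
Qed.

(** Values of [g] are constants or variables of index at least [K], so [msubst g B] captures
    nothing. *)
Lemma truth_lemma (w : world cmodel) (g : var -> universe cmodel) B :
    within K L B -> is_assignment w g ->
  sat w g B <-> derives (theory w) (msubst g B).
Proof.
elim: B w g => [|P ts|B IHB C IHC|B IHB|x B IHB] w g wB gw.
- by split=> // _; exact: der_top.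
(* [cconst] fixes the constants in [L], so evaluating these terms is substituting into them. *)
- have -> : msubst g (Rel P ts) = Rel P (map_tuple (teval w g) ts).
    congr Rel; apply: eq_from_tnth => i; rewrite !tnth_map.
    have /all_tnthP/(_ i) := wB.
    by case: (tnth ts i) => [//|c] /= cL; rewrite /cconst cL.
  split=> [[]//|wts]; split=> // t /tnthP[i ->].
  rewrite tnth_map; case: (tnth ts i) => [u|c] /=; [exact: gw|exact: cconst_dom].
- move: wB => /= /andP[wB wC]; split=> [[/(IHB w g wB gw) ? /(IHC w g wC gw) ?]|BC].
    exact: der_and.
  by split; [apply/IHB|apply/IHC] => //; apply: der_cut BC _;
     [exact: der_andl|exact: der_andr].
- split=> [[v [[wv hwv] vB]]|wdB].
    apply: der_cut wv (der_nec _); apply/IHB => // x.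
    exact: (fsubsetP (cdom_mono hwv)).
  (* The instance of [B] is itself the theory of the successor; the height is kept at least that of
     [w] so that [g] remains an assignment. *)
  have [v [vB hv]] := cworld_exists (msubst g B) (height w).
  exists v; split; first by split; rewrite ?vB.
  apply/IHB => //; first by move=> x; exact: (fsubsetP (cdom_mono hv)).
  by rewrite vB; exact: der_refl.
- move: (wB) => /= /andP[xK wB'].
  have low u y : y < K -> g u <> Var y.
    by move=> yK /in_tfv; apply/negP; exact: cdom_high (gw u) yK.
  split=> [satB|AB h hw hg].
    (* Truth at one fresh domain variable suffices, as it can be generalised. *)
    have [i /andP[hi iw] gi] := fresh_variable w g.
    apply: (@derives_All_intro _ _ (K + i)).
    + apply/negP => /fv_height; rewrite ltnNge => /negP; apply.
      exact: leq_trans hi (leq_addl _ _).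
    + by apply/negP => /(within_bv wB'); rewrite ltnNge leq_addr.
    + by move=> u /(within_fv wB); exact: gi.
    + by move=> u _; exact: low.
    + by rewrite gtn_eqF // ltn_addr.
    + have uw : is_assignment w (update g x (Var (K + i))).
        by move=> y; rewrite /update; case: eqP => // _; exact: mem_cdom_Var.
      apply/(IHB w _ wB' uw)/satB => // y; exact: update_neq.
  apply/IHB => //.
  rewrite (eq_msubst (h := update g x (h x))); last first.
    by move=> y _; rewrite /update; case: eqP => [->|/eqP /hg].
  apply: derives_All_elim AB; first by move=> u _; exact: low.
  by move=> y /(within_bv wB') yK; exact: cdom_high (hw x) yK.
Qed.

End CanonicalModel.

(** * Countermodel to an underivable sequent *)

Theorem theorem5p14 (Sg : signature) (phi psi : formula Sg) :
  ~ derives phi psi ->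
  exists (M : model Sg) (w : world M) (g : var -> universe M),
    [/\ adequate M, is_assignment w g, sat w g phi & ~ sat w g psi].
Proof.
move=> nphipsi.
have [K1 [L1 wphi1]] := within_exists phi.
have [K2 [L2 wpsi2]] := within_exists psi.
have /andP[] := within_join wphi1 wpsi2.
move: (maxn K1 K2) (L1 ++ L2) => K L wphi wpsi.
(* Variables below [K] are shifted into the domain; the others get the default [Var (K + 0)], as a
   finite domain cannot hold all shifts. *)
pose g x : universe (cmodel K L) := Var (K + if x < K then x else 0).
have [w [wE _]] := cworld_exists (msubst g phi) 0.
have gw : is_assignment (w : world (cmodel K L)) g.
  move=> x; apply: mem_cdom_Var; rewrite addnS ltnS.
  by case: ltnP => // xK; apply: leq_trans (ltnW xK) (leq_addl _ _).
have gE A : within K L A -> msubst (fun x => Var (K + x)) A = msubst g A.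
  by move=> wA; apply: eq_msubst => x /(within_fv wA) xK; rewrite /g xK.
exists (cmodel K L), w, g; split; [exact: cmodel_adequate|exact: gw| |].
  by apply/truth_lemma => //; rewrite wE; exact: der_refl.
(* Truth of [psi] would make the shifted sequent derivable, and the shift can be undone. *)
move/(truth_lemma wpsi gw); rewrite wE => phipsi; apply: nphipsi.
by apply: (derives_unshift wphi wpsi); rewrite !gE.
Qed.
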